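(* There exists a collection of cardinality $2^{\aleph_0}$ of pairwise non-isomorphic finitely generated torsion-free groups, each admitting a collection of cardinality $2^{\aleph_0}$ of measure-preserving essentially free actions on standard probability spaces, such that no two distinct actions in this whole collection (of actions of all these groups) are orbit equivalent.
   Context: An action is essentially free if the stabiliser of almost every point is trivial. Let $\Gamma,\Lambda$ be countable groups with measurable, measure-preserving, essentially free actions on standard probability spaces $(X,\mu)$ and $(Y,\nu)$ respectively. The actions are orbit equivalent if there is an isomorphism of measure spaces (modulo null sets) $F:X\to Y$ with $F(\Gamma x)=\Lambda F(x)$ for a.e. $x\in X$. *)

(* Defs.v *)
From HB Require Import structures.
From mathcomp Require Import all_boot all_order all_algebra.
From mathcomp Require Import all_classical all_reals all_analysis.

Set Implicit Arguments.
Unset Strict Implicit.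
Unset Printing Implicit Defensive.

Local Open Scope classical_set_scope.
Local Open Scope ring_scope.
Local Open Scope ereal_scope.

Definition is_subgroup (G : groupType) (H : set G) : Prop :=
  [/\ H 1%g, (forall x y, H x -> H y -> H (x * y)%g)
    & (forall x, H x -> H x^-1%g)].

Definition finitely_generated (G : groupType) : Prop :=
  exists2 A : set G, finite_set A & smallest (@is_subgroup G) A = [set: G].

Definition torsion_free (G : groupType) : Prop :=
  forall (g : G) (n : nat), (0 < n)%N -> (g ^+ n)%g = 1%g -> g = 1%g.

Definition isomorphic_groups (G H : groupType) : Prop :=
  exists f : {multiplicative G -> H}, bijective f.

Definition polish_metric (R : realType) (T : metricType R) : Prop :=
  (forall F : set_system T, ProperFilter F -> cauchy F -> exists l : T, F --> l)
  /\ (exists2 D : set T, countable D & dense D).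

(* The sigma-algebra of X is the Borel sigma-algebra of a Polish space, the
   metric being carried by a type T in bijection with X. *)
Definition standard_borel (R : realType) (d : measure_display)
    (X : measurableType d) : Prop :=
  exists (T : metricType R) (f : X -> T),
    [/\ polish_metric T, bijective f
      & @measurable d X = preimage_set_system [set: X] f <<s @open T >>].

Definition is_action (G : groupType) (X : Type) (a : G -> X -> X) : Prop :=
  (forall x, a 1%g x = x) /\
  (forall g h x, a (g * h)%g x = a g (a h x)).

Definition action_orbit (G : groupType) (X : Type) (a : G -> X -> X) (x : X) :
    set X :=
  range (fun g => a g x).

Definition stabiliser (G : groupType) (X : Type) (a : G -> X -> X) (x : X) :
    set G :=
  [set g | a g x = x].

Definition measure_preserving (R : realType) (d : measure_display)
    (X : measurableType d) (mu : probability X R) (f : X -> X) : Prop :=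
  forall A, measurable A -> mu (f @^-1` A) = mu A.

Definition essentially_free (R : realType) (d : measure_display)
    (X : measurableType d) (mu : probability X R) (G : groupType)
    (a : G -> X -> X) : Prop :=
  {ae mu, forall x, stabiliser a x = [set 1%g]}.

(* An action of G together with the standard probability space acted upon.
   Measurability is required elementwise, which for countable (discrete) G is
   the same as joint measurability on G x X. *)
Record free_pmp_action (R : realType) (G : groupType) := FreePmpAction {
  fpa_display : measure_display;
  fpa_space : measurableType fpa_display;
  fpa_prob : probability fpa_space R;
  fpa_act : G -> fpa_space -> fpa_space;
  fpa_standard : standard_borel R fpa_space;
  fpa_action : is_action fpa_act;
  fpa_measurable : forall g, measurable_fun [set: fpa_space] (fpa_act g);
  fpa_preserving : forall g, measure_preserving fpa_prob (fpa_act g);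
  fpa_free : essentially_free fpa_prob fpa_act
}.

(* F is total, but its values outside the conull set X0 are irrelevant. *)
Definition isomorphism_mod0 (R : realType) (d d' : measure_display)
    (X : measurableType d) (Y : measurableType d')
    (mu : probability X R) (nu : probability Y R) (F : X -> Y) : Prop :=
  exists (X0 : set X) (Y0 : set Y),
    [/\ measurable X0 /\ mu (~` X0) = 0,
        measurable Y0 /\ nu (~` Y0) = 0,
        set_bij X0 Y0 F,
        measurable_fun X0 F
      & forall A, measurable A -> A `<=` X0 ->
          measurable (F @` A) /\ nu (F @` A) = mu A].

Definition orbit_equivalent (R : realType) (G H : groupType)
    (a : free_pmp_action R G) (b : free_pmp_action R H) : Prop :=
  exists F : fpa_space a -> fpa_space b,
    isomorphism_mod0 (fpa_prob a) (fpa_prob b) F /\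
    {ae fpa_prob a, forall x,
       F @` action_orbit (@fpa_act _ _ a) x
         = action_orbit (@fpa_act _ _ b) (F x)}.

(* Main.v *)
Require Import Defs.
From HB Require Import structures.
From mathcomp Require Import all_boot all_order all_algebra.
From mathcomp Require Import all_classical all_reals all_analysis.
From mathcomp Require Import ring lra.

Set Implicit Arguments.
Unset Strict Implicit.
Unset Printing Implicit Defensive.

Import Order.TTheory GRing.Theory Num.Theory.

Local Open Scope classical_set_scope.

(** The actions constructed below have two ergodic components each, and the mass
    of the smaller one tells the whole collection apart. If almost every orbit is mapped onto an
    orbit, then invariant sets are carried to (almost) invariant sets of the same
    measure (orbit_equivalent_invariant_set), so the measures of the invariant
    sets are the same for orbit equivalent actions, whichever groups act.
    Given a countable infinite torsion-free group G and 0 < t < 1, let G act on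
    two disjoint copies of its Bernoulli shift {0,1}^G, one of total mass t and
    the other of mass 1 - t. The Bernoulli shift is free and ergodic
    (coin_shift_fix, coin_ergodic), so that the measures of the invariant sets
    are 0, t, 1 - t and 1 (mix_act_ergodic_parts), and t is an invariant of
    orbit equivalence as long as t < 1/2. It remains to take t in the form
    weight i s for an injection weight of pairs of binary sequences into
    ]0, 1/2[.

    The groups are of the kind introduced by P. Hall. For a sequence gam of
    elements of an abelian group C indexed by the integers, consider the
    permutations T (shift w), E (add w 0 to z) and F (add gam to w) of the set
    of pairs (z, w), with z in C and w a two-sided sequence in C. The commutator
    of E with T^n F T^-n is the translation of z by gam n, so the group that
    T, E and F generate contains all these translations. Letting C be
    the ring of fractions Z[1/p, p in S] and gam enumerate the 1/n with n a
    product of primes in S, one gets a torsion-free group in which a nontrivial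
    element with p^k-th roots for all k exists exactly when p is in S
    (hall_family_divisible). Hence distinct sets of primes give non-isomorphic
    groups.

    Everything about the coin measure rests on the flips of single coordinates:
    a finite measure invariant under all of them is a multiple of the coin
    measure (flip_invariant_measure). Applied to the image of the coin measure
    under a permutation of the coordinates, this says that the shift preserves
    the measure; applied to its restriction to a shift-invariant set C, which is
    invariant under flips too (shift_invariant_flip), it says that C is
    independent of itself. *)

(** * Subgroups generated by a set *)

Lemma morph_1g (G H : groupType) (f : G -> H) :
  {morph f : x y / (x * y)%g} -> f 1%g = 1%g.
Proof. by move=> fM; apply: (@mulgI _ (f 1%g)); rewrite -fM !mulg1. Qed.

Lemma morph_expgn (G H : groupType) (f : G -> H) :
  {morph f : x y / (x * y)%g} -> forall x n, f (x ^+ n)%g = (f x ^+ n)%g.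
Proof.
move=> fM x; elim=> [|n IH]; first by rewrite !expg0 morph_1g.
by rewrite !expgS fM IH.
Qed.

Section GeneratedSubgroup.
Variable K : groupType.
Implicit Type A : set K.

Lemma is_subgroup_smallest A : is_subgroup (smallest (@is_subgroup K) A).
Proof.
split=> [H [[]]//|x y Hx Hy H HA|x Hx H HA]; case: (HA) => [[H1 HM HV] _].
- exact: HM (Hx _ HA) (Hy _ HA).
- exact: HV (Hx _ HA).
Qed.

Definition in_span A : {pred K} :=
  fun x => `[< smallest (@is_subgroup K) A x >].

Lemma in_span_closed A : group_closed (in_span A).
Proof.
have [H1 HM HV] := is_subgroup_smallest A.
split=> [|x y /asboolP Hx /asboolP Hy]; apply/asboolP => //.
by apply: HM => //; exact: HV.
Qed.

Definition span_group A : Type := {x : K | in_span A x}.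

HB.instance Definition _ A := [isSub of span_group A for @sval K _].
HB.instance Definition _ A := [Choice of span_group A by <:].
HB.instance Definition _ A :=
  SubChoice_isSubGroup.Build K (in_span A) (span_group A) (in_span_closed A).

Definition span_in A (x : K) (Ax : A x) : span_group A :=
  exist _ x (introT (asboolP _) (@sub_gen_smallest _ _ A x Ax)).

Lemma span_group_fg A : finite_set A -> finitely_generated (span_group A).
Proof.
move=> finA; exists (\val @^-1` A : set (span_group A)).
  by apply: finite_preimage => // x y _ _; exact: val_inj.
apply/seteqP; split=> // x _ H [[H1 HM HV] AH].
have : in_span A (\val x) := valP x.
move/asboolP => /(_ [set y | exists2 u : span_group A, val u = y & H u])[].
  split; last first.
    by move=> y Ay; exists (span_in Ay) => //; exact: AH.
  split.
  - by exists 1%g; rewrite ?val1.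
  - move=> _ _ [u <- Hu] [v <- Hv]; exists (u * v)%g; last exact: HM.
    by rewrite valM.
  - move=> _ [u <- Hu]; exists (u^-1)%g; last exact: HV.
    exact: (gmulfV (val : {multiplicative span_group A -> K})).
by move=> u /val_inj <-.
Qed.

End GeneratedSubgroup.

Lemma finitely_generated_countable (G : groupType) :
  finitely_generated G -> countable [set: G].
Proof.
move=> [A finA AG].
have /finite_seqP[s sA] := finA.
pose letter (l : bool * nat) :=
  let x := nth 1%g s l.2 in if l.1 then (x^-1)%g else x.
pose word w := foldr (fun l x => letter l * x)%g 1%g w.
have word_cat v w : word (v ++ w) = (word v * word w)%g.
  by elim: v => [|l v IH] /=; rewrite ?mul1g// IH mulgA.
suff -> : [set: G] = range word by apply: sub_countable (card_image_le _ _) (countableP _).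
apply/seteqP; split=> // x _.
have : [set: G] x by [].
rewrite -AG; apply; split; last first.
  move=> y; rewrite sA /= => ys; exists [:: (false, index y s)] => //=.
  by rewrite /letter /= nth_index // mulg1.
split.
- by exists [::].
- by move=> _ _ [v _ <-] [w _ <-]; exists (v ++ w).
- move=> _ [w _ <-]; exists (rev [seq (~~ l.1, l.2) | l <- w]) => //.
  elim: w => [|[b n] w IH] /=; first by rewrite invg1.
  rewrite rev_cons -cats1 word_cat IH /= mulg1 invgM /letter /=.
  by case: b => /=; rewrite ?invgK.
Qed.

(** * Skew products over shifts of sequences *)

Section Skew.
Variable C : zmodType.
Local Open Scope ring_scope.

(** The permutation (z, w) |-> (z + a w, T^n w + b) of C * C^Z, where T is the
    shift, is encoded by n, b and a. The map a may be any function, not only an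
    additive one: such permutations still form a group, and torsion and roots in
    it are read off from the values of a alone. *)
Record skew := Skew {
  sk_shift : int;
  sk_trans : int -> C;
  sk_cocycle : (int -> C) -> C }.

HB.instance Definition _ := gen_eqMixin skew.
HB.instance Definition _ := gen_choiceMixin skew.

Lemma skew_eq (x y : skew) : sk_shift x = sk_shift y ->
  sk_trans x =1 sk_trans y -> sk_cocycle x =1 sk_cocycle y -> x = y.
Proof.
by case: x y => [n b a] [m c d] /= -> /funext -> /funext ->.
Qed.

(** The permutation induced on the second factor C^Z, over which the
    multiplication is the usual cocycle rule. *)
Definition skew_base (x : skew) (w : int -> C) : int -> C :=
  fun k => w (k + sk_shift x) + sk_trans x k.

Definition skew_one := Skew 0 (fun=> 0) (fun=> 0).

Definition skew_mul (x y : skew) := Skew (sk_shift x + sk_shift y)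
  (skew_base x (sk_trans y))
  (fun w => sk_cocycle y w + sk_cocycle x (skew_base y w)).

Definition skew_unbase (x : skew) (w : int -> C) : int -> C :=
  fun k => w (k - sk_shift x) - sk_trans x (k - sk_shift x).

Definition skew_inv (x : skew) := Skew (- sk_shift x)
  (skew_unbase x (fun=> 0)) (fun w => - sk_cocycle x (skew_unbase x w)).

Lemma skew_base_mul x y w :
  skew_base (skew_mul x y) w = skew_base x (skew_base y w).
Proof. by apply/funext => k; rewrite /skew_base /= addrA addrA. Qed.

Lemma skew_mulA : associative skew_mul.
Proof.
move=> x y z; apply: skew_eq => [|k|w] /=; first exact: addrA.
  by rewrite skew_base_mul.
by rewrite skew_base_mul addrA.
Qed.

Lemma skew_mul1 : left_id skew_one skew_mul.
Proof.
move=> x; apply: skew_eq => [|k|w] /=; rewrite ?add0r// ?addr0//.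
by rewrite /skew_base /= addr0 addr0.
Qed.

Lemma skew_base1 w : skew_base skew_one w = w.
Proof. by apply/funext => k; rewrite /skew_base /= !addr0. Qed.

Lemma skew_mulr1 : right_id skew_one skew_mul.
Proof.
move=> x; apply: skew_eq => [|k|w] /=; first exact: addr0.
  by rewrite /skew_base add0r.
by rewrite skew_base1 add0r.
Qed.

Lemma skew_baseK x : cancel (skew_base x) (skew_unbase x).
Proof.
by move=> w; apply/funext => k; rewrite /skew_base /skew_unbase subrK addrK.
Qed.

Lemma skew_unbaseK x : cancel (skew_unbase x) (skew_base x).
Proof.
by move=> w; apply/funext => k; rewrite /skew_base /skew_unbase addrK subrK.
Qed.

Lemma skew_mulV : left_inverse skew_one skew_inv skew_mul.
Proof.
move=> x; apply: skew_eq => [|k|w] /=; first by rewrite addNr.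
  by rewrite /skew_base /= /skew_unbase sub0r subrr.
by rewrite skew_baseK subrr.
Qed.

Lemma skew_mulrV : right_inverse skew_one skew_inv skew_mul.
Proof.
move=> x; apply: skew_eq => [|k|w] /=; first by rewrite subrr.
  by rewrite skew_unbaseK.
have -> : skew_base (skew_inv x) w = skew_unbase x w.
  by apply/funext => k; rewrite /skew_base /= /skew_unbase sub0r.
by rewrite addNr.
Qed.

HB.instance Definition _ :=
  isGroup.Build skew skew_mulA skew_mul1 skew_mulr1 skew_mulV skew_mulrV.

Lemma sk_shiftX (x : skew) n : sk_shift (x ^+ n)%g = sk_shift x *+ n.
Proof.
elim: n => [//|n IH]; rewrite expgS mulrS -IH //.
Qed.

Lemma sk_transX (x : skew) n k : sk_shift x = 0 ->
  sk_trans (x ^+ n)%g k = sk_trans x k *+ n.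
Proof.
move=> x0; elim: n => [//|n IH]; rewrite expgS mulrS -IH /=.
by rewrite /skew_base x0 addr0 addrC.
Qed.

Lemma sk_cocycleX (x : skew) n w : sk_shift x = 0 ->
  sk_trans x =1 (fun=> 0) -> sk_cocycle (x ^+ n)%g w = sk_cocycle x w *+ n.
Proof.
move=> x0 t0; elim: n => [//|n IH]; rewrite expgS mulrSr -IH /=.
congr (_ + sk_cocycle x _); apply/funext => k.
by rewrite /skew_base sk_shiftX sk_transX // x0 t0 !mul0rn !addr0.
Qed.

Hypothesis C_tf : forall (c : C) n, (0 < n)%N -> c *+ n = 0 -> c = 0.

(** The shift, the translation and the cocycle are homomorphisms to
    torsion-free groups on successively smaller subgroups, the kernels of the
    previous ones. *)
Lemma skew_torsion_free : torsion_free skew.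
Proof.
move=> x n n0 xn.
have x0 : sk_shift x = 0.
  apply/eqP; have /eqP := congr1 sk_shift xn.
  by rewrite sk_shiftX mulrn_eq0 gtn_eqF.
have t0 : sk_trans x =1 (fun=> 0).
  by move=> k; apply: (@C_tf _ n) => //; rewrite -sk_transX // xn.
apply: skew_eq => // w; apply: (@C_tf _ n) => //.
by rewrite -sk_cocycleX // xn.
Qed.

(** The isomorphism invariant that distinguishes the groups: the set of p for
    which such an element other than the identity exists. *)
Definition infinitely_divisible (G : groupType) (p : nat) (z : G) :=
  forall k, exists h : G, (h ^+ (p ^ k))%g = z.

Variable p : nat.
Hypothesis p_gt1 : (1 < p)%N.
Hypothesis C_sep : forall c : C, (forall k, exists d, d *+ (p ^ k) = c) -> c = 0.

(** A nonzero n cannot be divisible by p ^ |n|, which exceeds it. *)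
Lemma int_divisible0 (n : int) : (forall k, exists m : int, m *+ (p ^ k) = n) ->
  n = 0.
Proof.
move=> /(_ `|n|%N)[m mn]; apply/eqP; rewrite -absz_eq0; apply/negPn/negP.
have : (p ^ `|n| %| `|n|)%N.
  by rewrite -{2}mn -mulr_natr abszM natz absz_nat dvdn_mull.
move=> /dvdn_leq + n0; rewrite lt0n n0 => /(_ isT).
by rewrite leqNgt ltn_expl.
Qed.

(** The roots of z also have shift 0 and translation 0, since these components
    are multiplied by p ^ k in the power and live in torsion-free groups; so each
    component of z in turn is divisible by all powers of p. *)
Lemma skew_separated (z : skew) : infinitely_divisible p z -> z = 1%g.
Proof.
move=> zdiv.
have z0 : sk_shift z = 0.
  by apply: int_divisible0 => k; have [h <-] := zdiv k;
     exists (sk_shift h); rewrite sk_shiftX.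
have pk0 k : (0 < p ^ k)%N by rewrite expn_gt0 (ltnW p_gt1).
have h0 h k : (h ^+ (p ^ k))%g = z -> sk_shift h = 0.
  move=> hz; apply/eqP; move/eqP: z0.
  by rewrite -hz sk_shiftX mulrn_eq0 gtn_eqF.
have t0 : sk_trans z =1 (fun=> 0).
  move=> i; apply: C_sep => k; have [h hz] := zdiv k; exists (sk_trans h i).
  by rewrite -hz sk_transX // (h0 _ _ hz).
apply: skew_eq => // w; apply: C_sep => k; have [h hz] := zdiv k.
exists (sk_cocycle h w); rewrite -hz sk_cocycleX ?(h0 _ _ hz) // => i.
by apply: (@C_tf _ (p ^ k)) => //; rewrite -sk_transX ?(h0 _ _ hz) // hz t0.
Qed.

End Skew.

(** * A three-generator centre-by-metabelian group *)

Section HallGroup.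
Variables (C : zmodType) (gam : int -> C).
Local Open Scope ring_scope.

Definition hall_T : skew C := Skew 1 (fun=> 0) (fun=> 0).
Definition hall_E : skew C := Skew 0 (fun=> 0) (fun w => w 0).
Definition hall_F : skew C := Skew 0 gam (fun=> 0).

(** P. Hall's construction: hall_E and the conjugates of hall_F under hall_T
    generate a group of Heisenberg type, whose centre contains infinitely many
    translations of the first factor, prescribed by gam. *)
Definition hall := span_group [set hall_T; hall_E; hall_F].

Lemma hall_fg : finitely_generated hall.
Proof. exact/span_group_fg/finite_set3. Qed.

Definition vertical (c : C) : skew C := Skew 0 (fun=> 0) (fun=> c).

Lemma verticalX c n : (vertical c ^+ n)%g = vertical (c *+ n).
Proof.
apply: skew_eq => [|k|w]; rewrite ?sk_shiftX ?sk_transX ?sk_cocycleX //=.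
- exact: mul0rn.
- exact: mul0rn.
Qed.

(** The translation of the first factor by gam n is the commutator of E and
    T^n F T^-n. *)
Lemma vertical_in (n : nat) :
  in_span [set hall_T; hall_E; hall_F] (vertical (gam n%:Z)).
Proof.
set A := [set _; _; _].
have [S1 SM SV] := is_subgroup_smallest A.
have AS x : A x -> smallest (@is_subgroup _) A x := @sub_gen_smallest _ _ A x.
have ST : smallest (@is_subgroup _) A hall_T by apply: AS; left; left.
have SE : smallest (@is_subgroup _) A hall_E by apply: AS; left; right.
have SF : smallest (@is_subgroup _) A hall_F by apply: AS; right.
pose Tn : skew C := Skew n%:Z (fun=> 0) (fun=> 0).
have STn : smallest (@is_subgroup _) A Tn.
  rewrite /Tn; elim: (n) => [//|m IH].
  rewrite (_ : Skew _ _ _ = (hall_T * Skew m%:Z (fun=> 0) (fun=> 0))%g).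
    exact: SM.
  by apply: skew_eq => [|k|w] /=; rewrite ?addr0 // /skew_base /= addr0.
pose Fn : skew C := Skew 0 (fun k => gam (k + n%:Z)) (fun=> 0).
have FnE : (Tn * hall_F * Tn^-1)%g = Fn.
  apply: (@mulIg _ Tn); rewrite mulgVK.
  apply: skew_eq => [|k|w] /=; rewrite ?addr0 ?add0r //.
  by rewrite /skew_base /= addr0 add0r.
have SFn : smallest (@is_subgroup _) A Fn.
  by rewrite -FnE; apply: (SM); [apply: (SM)|exact: SV].
apply/asboolP.
rewrite (_ : vertical _ = ((Fn * hall_E)^-1 * (hall_E * Fn))%g).
  by apply: (SM); [apply: SV|]; apply: (SM).
apply: (@mulgI _ (Fn * hall_E)%g); rewrite mulVKg.
apply: skew_eq => [|k|w] /=; rewrite ?addr0 //.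
  by rewrite /skew_base /= /skew_base /= !addr0 !add0r.
by rewrite /skew_base /= !addr0 !add0r addrC.
Qed.

Lemma hall_torsion_free :
  (forall (c : C) n, (0 < n)%N -> c *+ n = 0 -> c = 0) -> torsion_free hall.
Proof.
move=> Ctf x n n0 xn; apply: val_inj; rewrite val1.
by apply: (skew_torsion_free Ctf n0); rewrite -(morph_expgn (@valM _ _ _)) xn val1.
Qed.

Lemma hall_separated (p : nat) : (1 < p)%N ->
  (forall (c : C) n, (0 < n)%N -> c *+ n = 0 -> c = 0) ->
  (forall c : C, (forall k, exists d, d *+ (p ^ k) = c) -> c = 0) ->
  forall z : hall, infinitely_divisible p z -> z = 1%g.
Proof.
move=> p1 Ctf Csep z zdiv; apply: val_inj; rewrite val1.
apply: (skew_separated Ctf p1 Csep) => k; have [h <-] := zdiv k.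
by exists (val h); rewrite (morph_expgn (@valM _ _ _)).
Qed.

Definition hall_vertical (n : nat) : hall :=
  exist (fun x => in_span _ x) _ (vertical_in n).

Lemma hall_divisible (p : nat) (c : C) : c != 0 ->
  (forall k, exists n : nat, gam n%:Z *+ p ^ k = c) ->
  exists2 z : hall, infinitely_divisible p z & z != 1%g.
Proof.
move=> c0 cdiv; have [n] := cdiv 0%N; rewrite expn0 mulr1n => nc.
exists (hall_vertical n).
  move=> k; have [m mE] := cdiv k; exists (hall_vertical m).
  by apply: val_inj; rewrite (morph_expgn (@valM _ _ _)) /= verticalX mE nc.
apply: contraNneq c0 => /(congr1 val); rewrite val1 /= nc.
by move/(congr1 (fun x => sk_cocycle x (fun=> 0))) => /= ->.
Qed.

End HallGroup.

Lemma infinitely_divisible_iso (G H : groupType) (p : nat) :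
  isomorphic_groups G H ->
  (exists2 z : G, infinitely_divisible p z & z != 1%g) ->
  exists2 z : H, infinitely_divisible p z & z != 1%g.
Proof.
move=> [f fbij] [z zdiv z1]; exists (f z).
  by move=> k; have [h <-] := zdiv k; exists (f h); rewrite (morph_expgn (@gmulfM _ _ f)).
by rewrite -(morph_1g (@gmulfM _ _ f)) (inj_eq (bij_inj fbij)).
Qed.

Lemma isomorphic_groups_sym (G H : groupType) :
  isomorphic_groups G H -> isomorphic_groups H G.
Proof.
move=> [f [g fK gK]].
have gM : {morph g : x y / (x * y)%g}.
  by move=> x y; apply: (can_inj fK); rewrite gmulfM !gK.
pose g' : {multiplicative H -> G} := HB.pack g (isMultiplicative.Build H G g gM).
by exists g'; exists f.
Qed.

(** * Localizations of the integers *)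

Section Localization.
Variable S : nat_pred.
Local Open Scope ring_scope.

Definition loc_int_pred : {pred rat} :=
  fun q => `[< exists2 m : nat, S.-nat m & q * m%:R \is a Num.int >].

Lemma loc_int_closed : zmod_closed loc_int_pred.
Proof.
split; first by apply/asboolP; exists 1%N; rewrite ?mul0r // rpred0.
move=> x y /asboolP[m mS xm] /asboolP[n nS yn]; apply/asboolP.
exists (m * n)%N; first by rewrite pnatM mS.
rewrite natrM mulrBl mulrA rpredB //; first by rewrite rpredM // natr_int.
by rewrite mulrCA rpredM // natr_int.
Qed.

Definition loc_int : Type := {q : rat | loc_int_pred q}.
HB.instance Definition _ := [isSub of loc_int for @sval rat _].
HB.instance Definition _ := [Choice of loc_int by <:].
HB.instance Definition _ :=
  GRing.SubChoice_isSubZmodule.Build rat loc_int_pred loc_int loc_int_closed.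

Lemma val_loc_intMn (c : loc_int) n : val (c *+ n) = val c *+ n.
Proof. exact: (raddfMn (val : {additive loc_int -> rat})). Qed.

Lemma loc_int_tf (c : loc_int) n : (0 < n)%N -> c *+ n = 0 -> c = 0.
Proof.
move=> n0 /(congr1 val); rewrite val_loc_intMn raddf0 => /eqP.
by rewrite mulrn_eq0 gtn_eqF //= => /eqP c0; apply: val_inj; rewrite raddf0.
Qed.

(** A numerator N of c satisfies N n = M m p ^ k with n prime to p, so p ^ k
    divides N for every k. *)
Lemma loc_int_separated (p : nat) : prime p -> p \notin S ->
  forall c : loc_int, (forall k, exists d, d *+ (p ^ k) = c) -> c = 0.
Proof.
move=> p_pr pS c cdiv; apply: val_inj; rewrite raddf0.
have /asboolP[m mS /intrP[N cN]] : loc_int_pred (val c) := valP c.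
have m0 : m%:R != 0 :> rat by rewrite pnatr_eq0 -lt0n; case/andP: mS.
suff N0 : N = 0.
  by apply/eqP; have /eqP := cN; rewrite N0 mulf_eq0 (negPf m0) orbF.
apply: (@int_divisible0 p (prime_gt1 p_pr)) => k; have [d dc] := cdiv k.
have /asboolP[n nS /intrP[M dM]] : loc_int_pred (val d) := valP d.
have NM : N * n%:Z = M * m%:Z * (p ^ k)%:Z.
  apply/eqP; rewrite -(eqr_int rat) !intrM /= -cN -dM -dc val_loc_intMn.
  by rewrite -mulr_natr; apply/eqP; rewrite !pmulrn; ring.
have : ((p ^ k)%:Z %| N)%Z.
  rewrite -(@Gauss_dvdzl _ _ n%:Z); first by rewrite NM dvdz_mull.
  rewrite /coprimez /gcdz /= -[_ == _]/(coprime _ _).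
  rewrite coprimeXl // prime_coprime //.
  apply: contra pS => pn; case/andP: nS => n0 /allP; apply.
  by rewrite mem_primes p_pr n0.
by case/dvdzP => q ->; exists q; rewrite -mulr_natr natz.
Qed.

(** The value 0 at negative indices and at those that are not S-numbers only
    pads the sequence: the values used are the 1/n for n an S-number. *)
Definition loc_inv (k : int) : loc_int :=
  if k isn't Posz n then 0 else
  insubd (0 : loc_int) (if S.-nat n then (n%:R : rat)^-1 else 0).

Lemma val_loc_inv n : S.-nat n -> val (loc_inv n%:Z) = (n%:R)^-1.
Proof.
move=> nS; rewrite /loc_inv nS insubdK //; apply/asboolP; exists n => //.
by rewrite mulVf ?rpred1 // pnatr_eq0 -lt0n; case/andP: nS.
Qed.

Lemma loc_inv_div (p : nat) : p \in S -> prime p ->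
  forall k, exists n, loc_inv n%:Z *+ p ^ k = loc_inv 1.
Proof.
move=> pS p_pr k; exists (p ^ k)%N; apply: val_inj.
have pkS : S.-nat (p ^ k)%N by rewrite pnatX pnatE // pS.
rewrite val_loc_intMn !val_loc_inv // -[LHS]mulr_natr mulVf ?invr1 //.
by rewrite pnatr_eq0 -lt0n; case/andP: pkS.
Qed.

Lemma loc_inv1_neq0 : loc_inv 1 != 0.
Proof. by rewrite -(inj_eq val_inj) val_loc_inv // raddf0 invr1 oner_neq0. Qed.

End Localization.

(** * Continuum many finitely generated torsion-free groups *)

Section HallFamily.

Fixpoint prime_seq (n : nat) : nat :=
  if n is m.+1 then s2val (prime_above (prime_seq m)) else 2.

Lemma prime_seq_prime n : prime (prime_seq n).
Proof. by case: n => [//|n] /=; case: prime_above. Qed.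

Lemma prime_seq_inj : injective prime_seq.
Proof.
apply: incn_inj; apply: leq_mono; apply: homo_ltn; first exact: ltn_trans.
by move=> n /=; case: prime_above.
Qed.

(** Binary sequences are turned into sets of primes along an injective sequence
    of primes. *)
Definition prime_set (i : nat -> bool) : nat_pred :=
  [pred p | `[< exists2 n, i n & p = prime_seq n >]].

Lemma prime_seq_in i n : (prime_seq n \in prime_set i) = i n.
Proof.
apply/asboolP/idP => [[m im /prime_seq_inj ->] //|ni].
by exists n.
Qed.

Definition hall_family (i : nat -> bool) : groupType :=
  hall (@loc_inv (prime_set i)).

Lemma hall_family_fg i : finitely_generated (hall_family i).
Proof. exact: hall_fg. Qed.

Lemma hall_family_tf i : torsion_free (hall_family i).
Proof. exact: hall_torsion_free (@loc_int_tf _). Qed.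

Lemma hall_family_divisible (i : nat -> bool) n : i n <->
  exists2 z : hall_family i, infinitely_divisible (prime_seq n) z & z != 1%g.
Proof.
split=> [ni|[z zdiv /eqP z1]].
  apply: (@hall_divisible _ _ _ _ (loc_inv1_neq0 (prime_set i))).
  by apply: loc_inv_div; [rewrite prime_seq_in|exact: prime_seq_prime].
apply/negPn/negP => ni; apply: z1.
apply: (hall_separated (prime_gt1 (prime_seq_prime n))) zdiv.
- exact: loc_int_tf.
- by apply: loc_int_separated; [exact: prime_seq_prime|rewrite prime_seq_in].
Qed.

Lemma hall_family_inj i j :
  isomorphic_groups (hall_family i) (hall_family j) -> i = j.
Proof.
move=> ij; apply/funext => n; apply/idP/idP => /hall_family_divisible ndiv.
  by apply/hall_family_divisible; exact: infinitely_divisible_iso ndiv.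
apply/hall_family_divisible; apply: infinitely_divisible_iso ndiv.
exact: isomorphic_groups_sym.
Qed.

Lemma hall_family_nontrivial i : exists x : hall_family i, x != 1%g.
Proof.
exists (hall_vertical (@loc_inv (prime_set i)) 1).
apply: contraNneq (loc_inv1_neq0 (prime_set i)) => /(congr1 val).
rewrite val1 /= => /(congr1 (fun x => sk_cocycle x (fun=> 0%R))) /= ->.
by [].
Qed.

End HallFamily.

(** * The Cantor space as a standard Borel space *)

Definition cantor : Type := nat -> bool.

HB.instance Definition _ := gen_eqMixin cantor.
HB.instance Definition _ := gen_choiceMixin cantor.
HB.instance Definition _ := isPointed.Build cantor (fun=> false).

Definition cyl (s : seq bool) : set cantor := [set x | mkseq x (size s) = s].

(** The empty set is included so that this is a pi-system. *)
Definition cylinders : set (set cantor) := [set A | A = set0 \/ exists s, A = cyl s].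

HB.instance Definition _ :=
  Measurable.copy cantor (g_sigma_algebraType cylinders).

Lemma mkseq_eqP (x y : cantor) n :
  mkseq x n = mkseq y n <-> (forall k, (k < n)%N -> x k = y k).
Proof.
split=> [xy k kn|xy].
  by rewrite -(nth_mkseq false x kn) xy nth_mkseq.
by apply/eq_in_map => k; rewrite mem_iota => /andP[_ kn]; exact: xy.
Qed.

Lemma cylP s (x : cantor) :
  cyl s x <-> (forall k, (k < size s)%N -> x k = nth false s k).
Proof.
by rewrite /cyl /mkset -{2}(mkseq_nth false s); exact: mkseq_eqP.
Qed.

Lemma cyl_mkseq (x y : cantor) n : cyl (mkseq x n) y = (mkseq y n = mkseq x n).
Proof. by rewrite /cyl /mkset size_mkseq. Qed.

Lemma cyl_nil : cyl [::] = setT. Proof. by apply/seteqP; split. Qed.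

Lemma cyl_rcons s b : cyl (rcons s b) = cyl s `&` [set x | x (size s) = b].
Proof.
apply/seteqP; split=> x; rewrite /cyl /= size_rcons mkseqS.
  by move/rcons_inj => [-> <-].
by move=> [-> ->].
Qed.

Lemma cylinders_setI : setI_closed cylinders.
Proof.
move=> A B [->|[s ->]]; first by rewrite set0I; left.
move=> [->|[t ->]]; first by rewrite setI0; left.
wlog st : s t / (size s <= size t)%N => [H|].
  by case/orP: (leq_total (size s) (size t)) => /H // {}H; rewrite setIC.
have [[x [sx tx]]|/set0P/negP/negPn/eqP->] := pselect (cyl s `&` cyl t !=set0); last by left.
right; exists t; apply/seteqP; split=> y [] // ty; split=> //.
apply: etrans sx; apply/mkseq_eqP => k ks.
have : mkseq y (size t) = mkseq x (size t) := etrans ty (esym tx).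
by move/mkseq_eqP; apply; exact: leq_trans ks st.
Qed.

Lemma measurable_cyl s : measurable (cyl s).
Proof. by apply: sub_sigma_algebra; right; exists s. Qed.

Lemma measurable_coord n b : measurable [set x : cantor | x n = b].
Proof.
rewrite [X in measurable X](_ : _ =
    \bigcup_(s in [set s | size s = n]) cyl (rcons s b)).
  rewrite bigcup_mkcond; apply: countable_bigcupT_measurable => // s.
  by case: ifPn => // _; exact: measurable_cyl.
apply/seteqP; split=> [x /= xn|x [s /= sn]].
  exists (mkseq x n); rewrite /= ?size_mkseq //.
  by rewrite cyl_rcons /cyl /= size_mkseq.
by rewrite cyl_rcons sn => -[].
Qed.

Lemma measurable_cantor d (T : measurableType d) (f : T -> cantor) :
  (forall n b, measurable [set x | f x n = b]) -> measurable_fun setT f.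
Proof.
move=> mf; apply: (measurability cylinders) => //.
move=> _ [A [->|[s ->]] <-]; rewrite setTI; first by rewrite preimage_set0.
elim/last_ind: s => [|s b IH]; first by rewrite cyl_nil preimage_setT.
by rewrite cyl_rcons preimage_setI; apply: measurableI; [exact: IH|exact: mf].
Qed.

Section CantorMetric.
Variable R : realType.
Local Open Scope ring_scope.

Definition first_diff (x y : cantor) : nat :=
  if pselect (exists n, x n != y n) is left P then ex_minn P else 0%N.

Lemma first_diffP (x y : cantor) : x <> y ->
  x (first_diff x y) != y (first_diff x y) /\
  forall n, (n < first_diff x y)%N -> x n = y n.
Proof.
move=> xy; rewrite /first_diff; case: pselect => [P|nP].
  case: ex_minnP => m xm mmin; split=> // n; rewrite ltnNge => nm.
  by apply/eqP; apply: contraNT nm; exact: mmin.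
by exfalso; apply: xy; apply/funext => n; apply/eqP/negPn/negP => xyn; apply: nP; exists n.
Qed.

Lemma first_diff_le (x y : cantor) n : x n != y n -> (first_diff x y <= n)%N.
Proof.
move=> xyn; have xy : x <> y by move=> xy; rewrite xy eqxx in xyn.
have [_ xyd] := first_diffP xy; rewrite leqNgt; apply/negP => /xyd.
by apply/eqP.
Qed.

Definition cantor_dist (x y : cantor) : R :=
  if x == y then 0 else (first_diff x y).+1%:R^-1.

(** A copy of the Cantor space that carries the ultrametric; the copy depends on
    the field in which distances are measured. *)
Definition cantor_metric : Type := cantor.
HB.instance Definition _ := Choice.on cantor_metric.

Lemma cantor_distxx x : cantor_dist x x = 0.
Proof. by rewrite /cantor_dist eqxx. Qed.

Lemma cantor_dist_ge0 x y : 0 <= cantor_dist x y.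
Proof. by rewrite /cantor_dist; case: ifP. Qed.

Lemma cantor_dist_eq0 x y : cantor_dist x y = 0 -> x = y.
Proof.
rewrite /cantor_dist; case: eqP => // _ /eqP.
by rewrite invr_eq0 pnatr_eq0.
Qed.

Lemma cantor_dist_sym x y : cantor_dist x y = cantor_dist y x.
Proof.
rewrite /cantor_dist eq_sym; case: eqP => // xy; congr (_.+1%:R^-1).
have [d1 _] := first_diffP xy.
have [d2 _] := first_diffP (nesym xy).
by apply/eqP; rewrite eqn_leq !first_diff_le // eq_sym.
Qed.

Lemma cantor_dist_ge (x y : cantor) n : x n != y n -> n.+1%:R^-1 <= cantor_dist x y.
Proof.
move=> xyn; rewrite /cantor_dist ifF.
  by rewrite lef_pV2 ?posrE ?ltr0n // ler_nat ltnS first_diff_le.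
by apply: contra_neqF xyn => /eqP ->.
Qed.

Lemma cantor_dist_lt (x y : cantor) n :
  (cantor_dist x y < n.+1%:R^-1) <-> mkseq x n.+1 = mkseq y n.+1.
Proof.
split=> [xyn|/mkseq_eqP xyn].
  apply/mkseq_eqP => k kn; apply/eqP; apply: contraTT xyn => /cantor_dist_ge xyk.
  by rewrite -leNgt (le_trans _ xyk) // lef_pV2 ?posrE ?ltr0n // ler_nat.
rewrite /cantor_dist; case: eqP => [_|xy]; first by rewrite invr_gt0 ltr0n.
rewrite ltf_pV2 ?posrE ?ltr0n // ltr_nat ltnS ltnNge; apply/negP => dn.
by have [/eqP] := first_diffP xy; rewrite xyn.
Qed.

Lemma cantor_dist_triangle y x z :
  cantor_dist x z <= cantor_dist x y + cantor_dist y z.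
Proof.
have [->|/eqP xz] := eqVneq x z.
  by rewrite cantor_distxx addr_ge0 // cantor_dist_ge0.
have [xzd _] := first_diffP xz.
rewrite {1}/cantor_dist ifF; last exact/eqP.
have [xyd|xyd] := eqVneq (x (first_diff x z)) (y (first_diff x z)).
  rewrite -[leLHS]add0r lerD ?cantor_dist_ge0 // cantor_dist_ge //.
  by rewrite -xyd.
by rewrite -[leLHS]addr0 lerD ?cantor_dist_ge0 // cantor_dist_ge.
Qed.

HB.instance Definition _ := isMetric.Build R cantor_metric
  cantor_distxx cantor_dist_eq0 cantor_dist_sym cantor_dist_triangle.

Lemma cantor_ballE (x : cantor_metric) n :
  ball x (n.+1%:R^-1 : R) = [set y | mkseq x n.+1 = mkseq y n.+1].
Proof.
by rewrite ballEmdist; apply/seteqP; split=> y /= /cantor_dist_lt.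
Qed.

Lemma near_inv_lt (e : R) : 0 < e -> exists n : nat, n.+1%:R^-1 < e.
Proof.
move=> e0; exists (Num.truncn e^-1); rewrite invf_plt ?posrE ?ltr0n //.
have e1 : 0 <= e^-1 by rewrite invr_ge0 ltW.
by have /andP[] := truncn_itv e1.
Qed.

Lemma cantor_nbhsP (x : cantor_metric) (A : set cantor_metric) :
  nbhs x A <-> exists n, cyl (mkseq x n) `<=` A.
Proof.
split=> [/nbhs_ballP[e /= e0 xA]|[n nA]].
  have [n ne] := near_inv_lt e0; exists n.+1 => y; rewrite cyl_mkseq => xy.
  by apply/xA/(le_ball (ltW ne)); rewrite cantor_ballE.
apply/nbhs_ballP; exists (n.+1%:R^-1) => /=; first by rewrite invr_gt0 ltr0n.
move=> y; rewrite cantor_ballE /mkset => xy; apply: nA; rewrite cyl_mkseq.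
by apply/esym; move: xy; rewrite !mkseqS => /rcons_inj[].
Qed.

Lemma cantor_complete (F : set_system cantor_metric) :
  ProperFilter F -> cauchy F -> exists l : cantor_metric, F --> l.
Proof.
move=> FF /cauchyP Fc.
have /choice[x xF] n : exists x : cantor_metric,
    F [set y | mkseq x n.+1 = mkseq y n.+1].
  have [|x] := Fc n.+1%:R^-1; first by rewrite invr_gt0 ltr0n.
  by rewrite cantor_ballE; exists x.
exists (fun n => x n n); apply/fcvg_ballP => e e0.
have [n ne] := near_inv_lt e0.
apply: filterS (xF n) => y xy; apply: (le_ball (ltW ne)).
rewrite cantor_ballE /= -xy; apply/mkseq_eqP => k; rewrite ltnS => kn.
have [z [/mkseq_eqP zk /mkseq_eqP zn]] := filter_ex (filterI (xF k) (xF n)).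
by rewrite zk // zn // ltnS.
Qed.

Lemma cantor_polish : polish_metric cantor_metric.
Proof.
split; first exact: cantor_complete.
exists (range (nth false : seq bool -> cantor_metric)).
  exact: sub_countable (card_image_le _ _) (countableP _).
move=> A [x Ax] Aop; have /cantor_nbhsP[n nA] : nbhs x A.
  by apply: open_nbhs_nbhs; split.
exists (nth false (mkseq x n)); split; last by exists (mkseq x n).
apply: nA; rewrite cyl_mkseq; apply/mkseq_eqP => k kn.
by rewrite nth_mkseq.
Qed.

(** There are countably many cylinders and they form a base of the topology, so
    every open set is a countable union of cylinders. *)
Lemma cantor_borel : @measurable _ cantor = <<s @open cantor_metric >>.
Proof.
apply/seteqP; split.
- apply: smallest_sub; first exact: smallest_sigma_algebra.
  move=> A [->|[s ->]]; apply: sub_sigma_algebra; first exact: open0.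
  rewrite openE => x xs; apply/cantor_nbhsP; exists (size s).
  by move=> y; rewrite cyl_mkseq [mkseq x _]xs.
- apply: smallest_sub; first exact: sigma_algebra_measurable.
  move=> A; rewrite openE => Aop.
  rewrite [X in _ X](_ : _ = \bigcup_(s in [set s | cyl s `<=` A]) cyl s).
    rewrite bigcup_mkcond; apply: (@countable_bigcupT_measurable _ cantor) => // s.
    by case: ifPn => // _; exact: measurable_cyl.
  apply/seteqP; split=> [x /Aop /cantor_nbhsP[n nA]|x [s sA sx]]; last exact: sA.
  by exists (mkseq x n) => //; rewrite cyl_mkseq.
Qed.

Lemma cantor_standard : standard_borel R cantor.
Proof.
exists cantor_metric, (fun x => x); split; first exact: cantor_polish.
  by exists (fun x => x).
rewrite cantor_borel; apply/seteqP; split=> [A mA|_ [A mA <-]].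
  by exists A; rewrite ?setTI.
by rewrite setTI.
Qed.

End CantorMetric.

(** * The fair coin measure *)

Section FairCoin.
Variable R : realType.
Local Open Scope ring_scope.

(** The binary expansion of u in [0, 1[. Its law under Lebesgue measure is the
    fair coin measure, which gives the infinite product measure without a
    product construction. *)
Definition digits (u : R) : cantor := fun n => odd (Num.truncn (2 ^+ n.+1 * u)).

Lemma measurable_truncn_le (c : R) k : 0 < c ->
  measurable [set u : R | (Num.truncn (c * u)%R <= k)%N].
Proof.
move=> c0; rewrite [X in measurable X](_ : _ = `]-oo, (k.+1%:R / c)[%classic).
  exact: measurable_itv.
apply/seteqP; split=> u /=; rewrite truncn_le_nat in_itv /= ltr_pdivlMr //.
  by rewrite mulrC.
by rewrite mulrC.
Qed.

Lemma measurable_digits : measurable_fun setT digits.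
Proof.
apply: measurable_cantor => n b; set c : R := 2 ^+ n.+1.
have c0 : 0 < c by rewrite exprn_gt0.
rewrite [X in measurable X](_ : _ =
  \bigcup_(k in [set k | odd k = b]) [set u : R | Num.truncn (c * u) = k]).
  apply: bigcup_measurable => -[|k] _.
    rewrite [X in measurable X](_ : _ = [set u : R | (Num.truncn (c * u)%R <= 0)%N]).
      exact: measurable_truncn_le.
    by apply/seteqP; split=> u /=; [move->|rewrite leqn0 => /eqP].
  rewrite [X in measurable X](_ : _ = [set u : R | (Num.truncn (c * u)%R <= k.+1)%N]
      `\` [set u : R | (Num.truncn (c * u)%R <= k)%N]).
    by apply: measurableD; exact: measurable_truncn_le.
  apply/seteqP; split=> u /=; first by move->; rewrite leqnn ltnn.
  by case=> uk /negP; rewrite -ltnNge => ku; apply/eqP; rewrite eqn_leq uk.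
apply/seteqP; split=> u /=; first by move=> <-; exists (Num.truncn (c * u)).
by case=> k /= <- <-.
Qed.

(** The integer with binary expansion s, most significant bit first. *)
Definition bin (s : seq bool) : nat := foldl (fun (a : nat) (b : bool) => (b + a.*2)%N) 0%N s.

Lemma bin_rcons s b : bin (rcons s b) = (b + (bin s).*2)%N.
Proof. by rewrite /bin foldl_rcons. Qed.

Lemma bin_lt s : (bin s < 2 ^ size s)%N.
Proof.
elim/last_ind: s => // s b IH; rewrite bin_rcons size_rcons expnS mul2n.
rewrite (@leq_trans (bin s).+1.*2) ?leq_double // doubleS ltnS.
by case: b; rewrite ?add1n ?add0n // ltnW.
Qed.

Lemma truncn_double (x : R) : 0 <= x -> (Num.truncn (2 * x))./2 = Num.truncn x.
Proof.
move=> x0; apply/esym/truncn_def.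
have /andP[] : (Num.truncn (2 * x))%:R <= 2 * x < (Num.truncn (2 * x)).+1%:R.
  by apply: truncn_itv; rewrite mulr_ge0.
rewrite -{1 2}(odd_double_half (Num.truncn (2 * x))).
move: (odd _) ((Num.truncn _)./2) => b t.
rewrite -muln2 -!natr1 natrD natrM => tx xt.
have b0 : (0 : R) <= b%:R by rewrite ler0n.
have b1 : (b%:R : R) <= 1 by case: (b).
apply/andP; split; lra.
Qed.

Lemma digits_cyl (u : R) s : 0 <= u < 1 ->
  cyl s (digits u) <-> Num.truncn (2 ^+ size s * u) = bin s.
Proof.
move=> /andP[u0 u1]; elim/last_ind: s => [|s b IH].
  rewrite cyl_nil expr0 mul1r; split=> // _; apply: truncn_def.
  by rewrite u0.
have t0 : 0 <= 2 ^+ size s * u by rewrite mulr_ge0 // exprn_ge0.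
rewrite cyl_rcons size_rcons bin_rcons.
have := truncn_double t0; rewrite mulrA -exprS => half.
rewrite -(odd_double_half (Num.truncn (_ ^+ (size s).+1 * _))) half.
split=> [[/IH -> /= <-] //|].
move=> E; have Eb : digits u (size s) = b.
  by have := congr1 odd E; rewrite !oddD !odd_double !addbF !oddb.
split=> //=; apply/IH; move: E; rewrite -Eb => /addnI.
by move/eqP; rewrite -!muln2 eqn_pmul2r // => /eqP.
Qed.

(** Prescribing the first n digits selects a dyadic interval of length
    2 ^- n. *)
Lemma digits_cyl_itv s : digits @^-1` cyl s `&` `[0, 1[%classic =
  `[(bin s)%:R / 2 ^+ size s, (bin s).+1%:R / 2 ^+ size s[%classic.
Proof.
have p0 : (0 : R) < 2 ^+ size s by rewrite exprn_gt0.
apply/seteqP; split=> u /=; rewrite !in_itv /=.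
  move=> [us u01]; have /andP[u0 u1] := u01.
  rewrite ler_pdivrMr // ltr_pdivlMr // mulrC.
  by move/(digits_cyl _ u01): us => <-; apply: truncn_itv; rewrite mulr_ge0 // ltW.
rewrite ler_pdivrMr // ltr_pdivlMr // mulrC => H.
have /andP[H1 H2] := H.
have u01 : 0 <= u < 1.
  apply/andP; split.
    by rewrite -(pmulr_rge0 _ p0) (le_trans _ H1).
  rewrite -(ltr_pM2l p0) mulr1 (lt_le_trans H2) // -natrX ler_nat.
  exact: bin_lt.
by split=> //; apply/(digits_cyl _ u01); exact: truncn_def.
Qed.

Let unit_lebesgue := mrestr (@lebesgue_measure R) (measurable_itv `[0, 1[).

Definition coin : set cantor -> \bar R := pushforward unit_lebesgue digits.

Let coin0 : coin set0 = 0%E.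
Proof. by apply: measure0; exact: measurable_digits. Qed.

Let coin_ge0 A : (0 <= coin A)%E. Proof. by apply: measure_ge0; exact: measurable_digits. Qed.

Let coin_sigma_additive : semi_sigma_additive coin.
Proof. by apply: measure_semi_sigma_additive; exact: measurable_digits. Qed.

HB.instance Definition _ :=
  isMeasure.Build _ _ _ coin coin0 coin_ge0 coin_sigma_additive.

Lemma coin_cyl s : coin (cyl s) = (2 ^- size s)%:E.
Proof.
rewrite /coin /pushforward /unit_lebesgue /mrestr.
rewrite [X in lebesgue_measure X]digits_cyl_itv lebesgue_measure_itv /= lte_fin.
rewrite ltr_pM2r ?invr_gt0 ?exprn_gt0 // ltr_nat ltnSn -EFinB -mulrBl.
by rewrite -natrB // subSnn mul1r.
Qed.

Let coin_setT : coin setT = 1%E.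
Proof. by rewrite -cyl_nil coin_cyl expr0 invr1. Qed.

HB.instance Definition _ := Measure_isProbability.Build _ _ _ coin coin_setT.

End FairCoin.

(** * Coordinate flips *)

Section Flip.
Variable R : realType.
Local Open Scope ring_scope.

Definition flip (n : nat) (x : cantor) : cantor := fun k => (k == n) (+) x k.

Lemma flipK n : involutive (flip n).
Proof. by move=> x; apply/funext => k; rewrite /flip addKb. Qed.

Lemma measurable_flip n : measurable_fun setT (flip n).
Proof.
apply: measurable_cantor => k b.
rewrite [X in measurable X](_ : _ = [set x : cantor | x k = (k == n) (+) b]).
  exact: measurable_coord.
by apply/seteqP; split=> x; rewrite /flip /=; case: (k == n) => /=; case: (x k); case: b.
Qed.

Lemma measurable_flip_preimage n A : measurable A -> measurable (flip n @^-1` A).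
Proof. by move=> mA; rewrite -[X in measurable X]setTI; exact: measurable_flip. Qed.

Lemma flip_cyl_ge s n : (size s <= n)%N -> flip n @^-1` cyl s = cyl s.
Proof.
move=> sn; have sf x k : (k < size s)%N -> flip n x k = x k.
  by move=> ks; rewrite /flip ltn_eqF // (leq_trans ks).
by apply/seteqP; split=> x /cylP xs; apply/cylP => k ks;
  have := xs k ks; rewrite sf.
Qed.

Lemma flip_cyl s b : flip (size s) @^-1` cyl (rcons s b) = cyl (rcons s (~~ b)).
Proof.
rewrite !cyl_rcons preimage_setI flip_cyl_ge //; congr (_ `&` _).
by apply/seteqP; split=> x; rewrite /flip /= eqxx; case: (x _); case: b.
Qed.

(** Flipping the last coordinate exchanges the two halves of a cylinder, so
    each has half the measure. *)
Lemma flip_invariant_cyl (m : {measure set cantor -> \bar R}) :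
  (m setT < +oo)%E ->
  (forall n A, measurable A -> m (flip n @^-1` A) = m A) ->
  forall s, (m (cyl s) = m setT * (2 ^- size s)%:E)%E.
Proof.
move=> mT minv; elim/last_ind => [|s b IH]; first by rewrite cyl_nil expr0 invr1 mule1.
have mfin A : measurable A -> m A \is a fin_num.
  move=> mA; rewrite ge0_fin_numE // (le_lt_trans _ mT) // le_measure ?inE //.
have mc := measurable_cyl.
have half c : m (cyl (rcons s (~~ c))) = m (cyl (rcons s c)).
  by rewrite -flip_cyl minv.
have split_cyl : m (cyl s) = (m (cyl (rcons s b)) + m (cyl (rcons s b)))%E.
  rewrite -{2}half -measureU //; first congr (m _).
    rewrite !cyl_rcons -setIUr [X in _ `&` X](_ : _ = setT) ?setIT //.
    apply/seteqP; split=> // x _; have [xb|xb] := eqVneq (x (size s)) b.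
      by left.
    by right => /=; move: xb; case: (x _); case: (b).
  rewrite !cyl_rcons setIACA [X in _ `&` X](_ : _ = set0) ?setI0 //.
  by apply/seteqP; split=> // x [/= -> ]; case: (b).
move: split_cyl; rewrite IH size_rcons.
have /fineK <- := mfin _ (mc (rcons s b)); have /fineK <- := mfin _ measurableT.
rewrite -!EFinM -EFinD => -[E]; congr (_%:E).
by rewrite exprS invfM mulrCA E; field.
Qed.

Lemma flip_invariant_measure (m : {measure set cantor -> \bar R}) :
  (m setT < +oo)%E ->
  (forall n A, measurable A -> m (flip n @^-1` A) = m A) ->
  forall A, measurable A -> (m A = m setT * coin R A)%E.
Proof.
move=> mfin minv A mA.
have mT : m setT \is a fin_num by rewrite ge0_fin_numE.
pose c : {nonneg R} := NngNum (fine_ge0 (measure_ge0 m setT)).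
have cE B : (mscale c (coin R) B = m setT * coin R B)%E.
  by rewrite /mscale /= fineK.
rewrite -cE.
apply: (measure_unique cylinders (fun=> cyl [::])) => //.
- exact: cylinders_setI.
- by move=> _; right; exists [::].
- by rewrite cyl_nil bigcup_const //; exists 0%N.
- move=> B [->|[s ->]]; first by rewrite !measure0.
  by rewrite [LHS](flip_invariant_cyl mfin minv) [RHS]cE coin_cyl.
- by move=> _; rewrite cyl_nil.
Qed.

(** A flip permutes the cylinders of each given length, and these all have the
    same measure. *)
Lemma coin_flip n A : measurable A -> coin R (flip n @^-1` A) = coin R A.
Proof.
move=> mA; pose m := pushforward (coin R) (flip n).
rewrite -[LHS]/(m A).
apply: (measure_unique cylinders (fun=> cyl [::])) => //.
- exact: cylinders_setI.
- by move=> _; right; exists [::].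
- by rewrite cyl_nil bigcup_const //; exists 0%N.
- exact: measurable_flip.
- move=> mf B [->|[s ->]]; first by rewrite !measure0.
  rewrite -[LHS]/(coin R (flip n @^-1` cyl s)).
  suff [t st ->] : exists2 t, size t = size s & flip n @^-1` cyl s = cyl t.
    by rewrite -[RHS]/(coin R (cyl s)) !coin_cyl st.
  exists (mkseq (flip n (nth false s)) (size s)); first by rewrite size_mkseq.
  apply/seteqP; split=> x /cylP; rewrite ?size_mkseq => xs; apply/cylP;
    rewrite ?size_mkseq => k ks; have := xs k ks; rewrite nth_mkseq // /flip.
    by move=> <-; rewrite addKb.
  by move=> ->; rewrite addKb.
- move=> mf _; rewrite cyl_nil -[ltLHS]/(coin R (flip n @^-1` setT)).
  by rewrite preimage_setT probability_setT ltry.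
Qed.

End Flip.

(** * The Bernoulli shift *)

Section RegularAction.
Variables (R : realType) (G : groupType) (d : nat -> G) (e : G -> nat).
Hypotheses (dK : cancel d e) (eK : cancel e d).
Local Notation P := (coin R).

(** The group is identified with the set of coordinates through the bijection
    d, with inverse e. *)
Definition shift (g : G) (x : cantor) : cantor := fun k => x (e (g^-1 * d k)%g).

Lemma shift_action : is_action shift.
Proof.
split=> [x|g h x]; apply/funext => k; rewrite /shift.
  by rewrite invg1 mul1g dK.
by rewrite eK invgM mulgA.
Qed.

Lemma shiftK g : cancel (shift g) (shift g^-1%g).
Proof.
by case: shift_action => s1 sM x; rewrite -sM mulVg s1.
Qed.

Lemma shift_flip g n x : shift g (flip n x) = flip (e (g * d n)%g) (shift g x).
Proof.
apply/funext => k; rewrite /shift /flip; congr (_ (+) _).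
apply/eqP/eqP => [<-|->]; first by rewrite eK mulVKg dK.
by rewrite eK mulKg dK.
Qed.

Lemma measurable_shift g : measurable_fun setT (shift g).
Proof. by apply: measurable_cantor => n b; exact: measurable_coord. Qed.

Lemma measurable_shift_preimage g A : measurable A -> measurable (shift g @^-1` A).
Proof. by move=> mA; rewrite -[X in measurable X]setTI; exact: measurable_shift. Qed.

(** The shift intertwines the flips, so the image measure is flip-invariant. *)
Lemma coin_shift g A : measurable A -> P (shift g @^-1` A) = P A.
Proof.
move=> mA; have mg := measurable_shift g; pose m := pushforward P (shift g).
have mT : m setT = 1%E by rewrite /m /pushforward preimage_setT probability_setT.
suff : m A = (m setT * P A)%E by rewrite mT mul1e.
apply: flip_invariant_measure => //; first by rewrite [ltLHS]mT ltry.
move=> n B mB.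
rewrite -[LHS]/(P (shift g @^-1` (flip n @^-1` B))) -[RHS]/(P (shift g @^-1` B)).
pose k := e (g^-1 * d n)%g.
have -> : shift g @^-1` (flip n @^-1` B) = flip k @^-1` (shift g @^-1` B).
  apply/seteqP; split=> x /=; rewrite shift_flip /k eK mulVKg dK //.
rewrite [LHS]coin_flip //; exact: measurable_shift_preimage.
Qed.

Hypothesis Gtf : torsion_free G.

Definition shift_fix g : set cantor := [set x | shift g x = x].

Lemma measurable_shift_fix g : measurable (shift_fix g).
Proof.
rewrite [X in measurable X](_ : _ =
  \bigcap_n [set x : cantor | shift g x n = x n]).
  apply: bigcapT_measurable => n.
  rewrite [X in measurable X](_ : _ = \bigcup_(b in [set: bool])
     ([set x : cantor | x (e (g^-1 * d n)%g) = b] `&` [set x | x n = b])).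
    apply: countable_bigcupT_measurable => // b.
    by apply: measurableI; exact: measurable_coord.
  apply/seteqP; split=> x /=; first by move=> xn; exists (x n).
  by case=> b _ [/= xb yb]; rewrite /shift xb yb.
apply/seteqP; split=> x /=; first by move=> xg n _ /=; rewrite xg.
by move=> xg; apply/funext => n; exact: xg.
Qed.

(** If flipping i or flipping j both turn x into a fixed point of g, then g x
    is x flipped at i and g i, and also x flipped at j and g j; as g moves i and
    j, it exchanges them, and g * g = 1. *)
Lemma shift_fix_flip_trivIset g : g != 1%g ->
  trivIset setT (fun n => flip n @^-1` shift_fix g).
Proof.
move=> g1; apply/trivIsetP => i j _ _ ij; rewrite -subset0 => x [/=].
have gg : (g * g)%g != 1%g.
  by apply: contra_neq g1 => gg; apply: (@Gtf g 2).
have fr h n : h != 1%g -> (e (h * d n)%g == n) = false.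
  move=> h1; apply/eqP => /(congr1 d); rewrite eK -{2}[d n]mul1g => /mulIg.
  by apply/eqP.
rewrite /shift_fix /= !shift_flip => gi gj.
set a := e (g * d i)%g in gi; set b := e (g * d j)%g in gj.
have E k : (k == a) (+) (k == i) = (k == b) (+) (k == j).
  have /= := congr1 (fun y => y k) gi; have /= := congr1 (fun y => y k) gj.
  rewrite /flip; case: (k == a); case: (k == i); case: (k == b);
  by case: (k == j); case: (shift g x k); case: (x k).
have ib : i = b.
  have := E i; rewrite eqxx /a eq_sym fr // (negPf ij) addbF.
  by move/esym/eqP.
have ja : j = a.
  have := E j; rewrite eqxx /b [j == e _]eq_sym fr // [j == i]eq_sym (negPf ij).
  by rewrite addbF => /eqP.
have ii : e (g * g * d i)%g = i by rewrite {2}ib /b ja /a eK mulgA.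
by have := fr _ i gg; rewrite ii eqxx.
Qed.

(** The flipped copies of the fixed set are infinitely many disjoint sets of
    the same measure. *)
Lemma coin_shift_fix g : g != 1%g -> P (shift_fix g) = 0%E.
Proof.
move=> g1; have mF := measurable_shift_fix g.
have mfF n : measurable (flip n @^-1` shift_fix g) by exact: measurable_flip_preimage.
have tri := shift_fix_flip_trivIset g1.
have le1 n : (P (shift_fix g) *+ n <= 1)%E.
  have mU : measurable (\big[setU/set0]_(i < n) (flip i @^-1` shift_fix g)).
    by apply: bigsetU_measurable => i _; exact: mfF.
  have E : P (\big[setU/set0]_(i < n) (flip i @^-1` shift_fix g)) =
      (\sum_(i < n) P (flip i @^-1` shift_fix g))%E.
    exact: measure_semi_additive mfF tri mU.
  have := probability_le1 P mU.
  rewrite [leLHS]E (eq_bigr (fun=> P (shift_fix g))) => [|i _]; last exact: coin_flip.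
  by rewrite big_const iter_addr_0 card_ord.
have Pfin : P (shift_fix g) \is a fin_num.
  exact: fin_num_measure.
move: le1; rewrite -(fineK Pfin); set p := fine _ => le1.
have p0 : (0 <= p)%R by exact: fine_ge0.
congr (_%:E); apply/eqP; rewrite eq_le p0 andbT leNgt; apply/negP => p_gt0.
have := le1 (Num.truncn p^-1).+1; apply/negP.
rewrite -EFin_natmul lee_fin -ltNge -mulr_natl -ltr_pdivrMr // div1r.
have pV0 : (0 <= p^-1)%R by rewrite invr_ge0.
by have /andP[] := truncn_itv pV0.
Qed.

End RegularAction.

(** * Ergodicity of the Bernoulli shift *)

Section Ergodicity.
Variables (R : realType).
Local Notation P := (coin R).

(** Flipping a remote coordinate hardly changes C. This holds for all measurable
    C, as it holds for cylinders and passes to complements and countable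
    unions. *)
Definition asymp_flip_invariant (C : set cantor) := forall eps : R, (0 < eps)%R ->
  exists N, forall n, (N <= n)%N -> (P (C `\` flip n @^-1` C) <= eps%:E)%E.

Lemma measurable_setD_flip n C : measurable C -> measurable (C `\` flip n @^-1` C).
Proof. by move=> mC; apply: measurableD => //; exact: measurable_flip_preimage. Qed.

Lemma coin_setD_flip n C : measurable C ->
  P (flip n @^-1` C `\` C) = P (C `\` flip n @^-1` C).
Proof.
move=> mC; rewrite -[RHS](@coin_flip R n) //; last exact: measurable_setD_flip.
by congr (P _); apply/seteqP; split=> x /=; rewrite flipK.
Qed.

Lemma asymp_flip_invariantU A B : measurable A -> measurable B ->
  asymp_flip_invariant A -> asymp_flip_invariant B ->
  asymp_flip_invariant (A `|` B).
Proof.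
move=> mA mB Ai Bi eps eps0; have e2 : (0 < eps / 2)%R by rewrite divr_gt0.
have [N1 H1] := Ai _ e2; have [N2 H2] := Bi _ e2.
exists (maxn N1 N2) => n; rewrite geq_max => /andP[/H1 h1 /H2 h2].
apply: (@le_trans _ _ (P ((A `\` flip n @^-1` A) `|` (B `\` flip n @^-1` B)))).
  rewrite le_measure ?inE //.
  - by apply: measurable_setD_flip; exact: measurableU.
  - by apply: measurableU; exact: measurable_setD_flip.
  - move=> x [[Ax|Bx] nx]; [left|right]; split=> // fx; apply: nx; by [left|right].
apply: (le_trans (measureU2 _ _ _)); try exact: measurable_setD_flip.
by rewrite [eps]splitr EFinD leeD.
Qed.

Lemma measurable_asymp_flip_invariant C : measurable C -> asymp_flip_invariant C.
Proof.
apply: (dynkin_induction _ cylinders_setI) => //.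
- by move=> eps eps0; exists 0%N => n _; rewrite preimage_setT setDv measure0 lee_fin ltW.
- move=> _ [->|[s ->]] eps eps0; last first.
    by exists (size s) => n sn; rewrite flip_cyl_ge // setDv measure0 lee_fin ltW.
  by exists 0%N => n _; rewrite preimage_set0 setDv measure0 lee_fin ltW.
- move=> A mA Ai eps eps0; have [N H] := Ai _ eps0; exists N => n nN.
  have -> : ~` A `\` flip n @^-1` (~` A) = flip n @^-1` A `\` A.
    by rewrite !setDE -preimage_setC setCK setIC.
  by rewrite coin_setD_flip // H.
- move=> F mF tF Fi eps eps0; have e2 : (0 < eps / 2)%R by rewrite divr_gt0.
  pose V m := \big[setU/set0]_(i < m.+1) F i.
  have mV m : measurable (V m) by apply: bigsetU_measurable => i _; exact: mF.
  have Vi m : asymp_flip_invariant (V m).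
    rewrite /V; elim: m => [|m IH]; first by rewrite big_ord1.
    by rewrite big_ord_recr /=; apply: asymp_flip_invariantU => //; exact: mV.
  have UV : \bigcup_k F k = \bigcup_m V m by rewrite bigcup_bigsetU_bigcup.
  have mU : measurable (\bigcup_k F k) by exact: bigcupT_measurable.
  have [m Vm] : exists m, (P (\bigcup_k F k `\` V m) <= (eps / 2)%:E)%E.
    (* By continuity from above, V m fills the union up to eps / 2. *)
    have T0 : \bigcap_m (\bigcup_k F k `\` V m) = set0.
      rewrite -subset0 UV => x H; have [[k _ Vx] _] := H 0%N I.
      by have [_] := H k I.
    have mT m : measurable (\bigcup_k F k `\` V m) by exact: measurableD.
    have := @nonincreasing_cvg_mu _ _ _ P (fun m => \bigcup_k F k `\` V m).
    rewrite T0 measure0 => /(_ _ mT measurable0 _ _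
      (nbhs_open_ereal_lt (f := fun=> (eps / 2)%R) e2)).
    case=> [||m _ /(_ m (leqnn m)) /= /ltW]; last by exists m.
    - by rewrite ltey_eq fin_num_measure.
    - move=> k m km; rewrite subsetEset; apply: setDS; exact: subset_bigsetU.
  have [N H] := Vi m _ e2; exists N => n /H VN.
  apply: (@le_trans _ _ (P ((\bigcup_k F k `\` V m) `|` (V m `\` flip n @^-1` V m)))).
    rewrite le_measure ?inE //.
    + exact: measurable_setD_flip.
    + by apply: measurableU; [exact: measurableD|exact: measurable_setD_flip].
    + move=> x [Ux nx]; have [Vx|] := pselect (V m x); last by left.
      right; split=> // fx; apply: nx; rewrite UV /=; by exists m.
  apply: (le_trans (measureU2 _ _ _)).
  - exact: measurableD.
  - exact: measurable_setD_flip.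
  - by rewrite [eps]splitr EFinD leeD.
Qed.

Lemma coin_setI_ae A B X : measurable A -> measurable B -> measurable X ->
  P (A `\` B) = 0%E -> P (B `\` A) = 0%E -> P (X `&` A) = P (X `&` B).
Proof.
move=> mA mB mX AB BA.
have H D E : measurable D -> measurable E -> P (D `\` E) = 0%E ->
    P (X `&` D) = P (X `&` D `&` E).
  move=> mD mE DE; rewrite (measureDI _ (measurableI _ _ mX mD) mE).
  rewrite [X in (X + _)%E](_ : _ = 0%E) ?add0e //.
  apply: (subset_measure0 _ _ _ DE).
  - by apply: measurableD => //; exact: measurableI.
  - exact: measurableD.
  - by move=> x [[_ Dx] Ex].
by rewrite (H A B) // (H B A) // -!setIA (setIC A).
Qed.

Variables (G : groupType) (d : nat -> G) (e : G -> nat).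
Hypotheses (dK : cancel d e) (eK : cancel e d).

(** An element g of the group that sends the coordinate n to a remote coordinate
    N conjugates the flip at n to the flip at N. The latter moves C by at most
    eps, and C is g-invariant. *)
Lemma shift_invariant_flip C : measurable C ->
  (forall g, P (C `\` shift d e g @^-1` C) = 0%E) ->
  forall n, P (C `\` flip n @^-1` C) = 0%E.
Proof.
move=> mC Cinv n; apply/eqP; rewrite eq_le measure_ge0 andbT.
apply/lee_addgt0Pr => eps eps0; rewrite add0e.
have [N /(_ N (leqnn N)) CN] := measurable_asymp_flip_invariant mC eps0.
pose g := (d N * (d n)^-1)%g; pose s := shift d e.
have gn : e (g * d n)%g = N by rewrite /g mulgVK dK.
have mD h : measurable (C `\` s h @^-1` C).
  by apply: measurableD => //; exact: measurable_shift_preimage.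
(* If x is in C but its flip at n is not, invariance of C fails at x (A1) or
   at g applied to the flip of x (A2), or else g x is moved out of C by the
   flip at N (A3). *)
pose A1 := C `\` s g @^-1` C.
pose A2 := flip n @^-1` (s g @^-1` (C `\` s g^-1%g @^-1` C)).
pose A3 := s g @^-1` (C `\` flip N @^-1` C).
have mA2 : measurable A2.
  by apply: measurable_flip_preimage; apply: measurable_shift_preimage; exact: mD.
have mA3 : measurable A3.
  by apply: measurable_shift_preimage; exact: measurable_setD_flip.
have A1_0 : P A1 = 0%E by exact: Cinv.
have A2_0 : P A2 = 0%E.
  rewrite /A2 coin_flip; last by apply: measurable_shift_preimage; exact: mD.
  by rewrite coin_shift //; exact: mD.
have A3_eps : (P A3 <= eps%:E)%E.
  by rewrite /A3 coin_shift //; exact: measurable_setD_flip.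
apply: (@le_trans _ _ (P (A1 `|` A2 `|` A3))).
  rewrite le_measure ?inE //.
  - exact: measurable_setD_flip.
  - by apply: measurableU => //; apply: measurableU => //; exact: mD.
  - move=> x [Cx fCx].
    have [gx|gx] := pselect (C (s g x)); last by left; left.
    have [fgx|fgx] := pselect (C (flip N (s g x))); last by right.
    left; right; rewrite /A2 /= /s shift_flip // gn; split=> // H; apply: fCx.
    by move: H; rewrite /s -gn -shift_flip // shiftK.
have mA12 : measurable (A1 `|` A2) by apply: measurableU => //; exact: mD.
apply: (le_trans (measureU2 _ mA12 mA3)).
rewrite -[leRHS]add0e leeD //.
apply: (le_trans (measureU2 _ (mD g) mA2)).
by rewrite [X in (X + _)%E]A1_0 [X in (_ + X)%E]A2_0 adde0.
Qed.

(** By invariance under the flips, the measure restricted to C is P C times P;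
    evaluating it at C gives P C = P C * P C. *)
Lemma coin_ergodic C : measurable C ->
  (forall g, P (C `\` shift d e g @^-1` C) = 0%E) -> P C = 0%E \/ P C = 1%E.
Proof.
move=> mC /(shift_invariant_flip mC) Cf.
have Pfin : P C \is a fin_num by exact: fin_num_measure.
have mE A : mrestr P mC A = P (A `&` C) by [].
have H : P C = (P C * P C)%E.
  rewrite -{1 2}[C]setTI -[X in (X * _)%E]mE -{1}[C]setIid setTI -mE.
  apply: flip_invariant_measure => //.
    by rewrite [ltLHS]mE setTI ltey_eq Pfin.
  move=> n A mA; rewrite [LHS]mE [RHS]mE -[RHS](@coin_flip R n); last exact: measurableI.
  rewrite preimage_setI; apply: coin_setI_ae => //; try exact: measurable_flip_preimage.
  by rewrite coin_setD_flip.
move: H; rewrite -(fineK Pfin) -EFinM => -[] /eqP.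
rewrite -{1}[fine _]mulr1 -subr_eq0 -mulrBr mulf_eq0 subr_eq0.
by move=> /orP[/eqP->|/eqP<-]; [left|right].
Qed.

End Ergodicity.

(** * Actions with two ergodic components of prescribed masses *)

Section Mixture.
Variables (R : realType) (t : R).
Hypothesis t01 : (0 < t < 1)%R.

Definition cons_bit (b : bool) (x : cantor) : cantor :=
  fun n => if n is m.+1 then x m else b.

Definition tail_bits (x : cantor) : cantor := fun n => x n.+1.

Lemma cons_tail x : cons_bit (x 0%N) (tail_bits x) = x.
Proof. by apply/funext => -[]. Qed.

Lemma measurable_cons_bit b : measurable_fun setT (cons_bit b).
Proof.
apply: measurable_cantor => -[|n] c /=; last exact: measurable_coord.
have [->|bc] := eqVneq b c.
  by rewrite [X in measurable X](_ : _ = setT) //; apply/seteqP; split.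
rewrite [X in measurable X](_ : _ = set0) // -subset0 => x /= bc'.
by rewrite bc' eqxx in bc.
Qed.

Lemma measurable_cons_preimage b A : measurable A -> measurable (cons_bit b @^-1` A).
Proof. by move=> mA; rewrite -[X in measurable X]setTI; exact: measurable_cons_bit. Qed.

Let t0 : (0 <= t)%R. Proof. by case/andP: t01 => /ltW. Qed.
Let t1 : (0 <= 1 - t)%R. Proof. by rewrite subr_ge0; case/andP: t01 => _ /ltW. Qed.

(** The coordinate 0 says which copy of the Bernoulli shift a point lies in. *)
Definition mix (A : set cantor) : \bar R :=
  (t%:E * coin R (cons_bit true @^-1` A) +
   (1 - t)%:E * coin R (cons_bit false @^-1` A))%E.

Let mix0 : mix set0 = 0%E.
Proof. by rewrite /mix !preimage_set0 measure0 !mule0 adde0. Qed.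

Let mix_ge0 A : (0 <= mix A)%E.
Proof. by rewrite /mix adde_ge0 // mule_ge0 // lee_fin. Qed.

Let mix_add : semi_sigma_additive mix.
Proof.
move=> F mF tF mU.
have H b : (\sum_(0 <= i < n) coin R (cons_bit b @^-1` F i))%E @[n --> \oo]
    --> coin R (cons_bit b @^-1` \bigcup_n F n).
  rewrite preimage_bigcup; apply: measure_semi_sigma_additive.
  - by move=> i; exact: measurable_cons_preimage.
  - apply/trivIsetP => i j _ _ ij; rewrite -preimage_setI.
    by move/trivIsetP : tF => /(_ _ _ I I ij) ->; rewrite preimage_set0.
  - by rewrite -preimage_bigcup; exact: measurable_cons_preimage.
pose S b n := (\sum_(0 <= i < n) coin R (cons_bit b @^-1` F i))%E.
rewrite [X in X @ _ --> _](_ : _ =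
    (fun n => t%:E * S true n + (1 - t)%:E * S false n)%E); last first.
  by apply/funext => n; rewrite big_split /= -!ge0_sume_distrr.
apply: cvgeD.
- by rewrite ge0_adde_def // inE mule_ge0 ?lee_fin.
- by apply: cvgeZl => //; exact: H.
- by apply: cvgeZl => //; exact: H.
Qed.

HB.instance Definition _ := isMeasure.Build _ _ _ mix mix0 mix_ge0 mix_add.

Let mix_setT : mix setT = 1%E.
Proof.
by rewrite /mix !preimage_setT probability_setT !mule1 -EFinD addrC subrK.
Qed.

HB.instance Definition _ := Measure_isProbability.Build _ _ _ mix mix_setT.

Lemma mix_eq0 A : mix A = 0%E -> forall b, coin R (cons_bit b @^-1` A) = 0%E.
Proof.
case/andP: t01 => t_gt0 t_lt1 /eqP; rewrite /mix padde_eq0 ?mule_ge0 ?lee_fin //.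
rewrite !mule_eq0 !eqe subr_eq0 (gt_eqF t_gt0) (gt_eqF t_lt1) /=.
by case/andP => /eqP H1 /eqP H2 [].
Qed.

Section MixAction.
Variables (G : groupType) (d : nat -> G) (e : G -> nat).
Hypotheses (dK : cancel d e) (eK : cancel e d).

Definition mix_act (g : G) (x : cantor) : cantor :=
  cons_bit (x 0%N) (shift d e g (tail_bits x)).

Lemma mix_act_cons g b x : mix_act g (cons_bit b x) = cons_bit b (shift d e g x).
Proof. by []. Qed.

Lemma mix_act_action : is_action mix_act.
Proof.
have [s1 sM] := shift_action dK eK.
split=> [x|g h x]; first by rewrite /mix_act s1 cons_tail.
by rewrite [mix_act h x]/mix_act mix_act_cons -sM.
Qed.

Lemma measurable_mix_act g : measurable_fun setT (mix_act g).
Proof. by apply: measurable_cantor => -[|n] b; exact: measurable_coord. Qed.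

Lemma mix_act_preimage g b A :
  cons_bit b @^-1` (mix_act g @^-1` A) = shift d e g @^-1` (cons_bit b @^-1` A).
Proof. by []. Qed.

Lemma mix_act_preserving g : measure_preserving (mix : probability cantor R) (mix_act g).
Proof.
move=> A mA; rewrite /= /mix.
by rewrite !mix_act_preimage !coin_shift //; exact: measurable_cons_preimage.
Qed.

Lemma mix_act_free : torsion_free G ->
  essentially_free (mix : probability cantor R) mix_act.
Proof.
move=> Gtf; pose F n := [set x | d n != 1%g /\ mix_act (d n) x = x].
have F0 n : (mix : probability cantor R).-negligible (F n).
  have [dn1|dn1] := eqVneq (d n) 1%g.
    rewrite (_ : F n = set0) //; first exact: negligible_set0.
    by rewrite -subset0 /F dn1 => x []; rewrite eqxx.
  have FE b : cons_bit b @^-1` F n = shift_fix d e (d n).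
    apply/seteqP; split=> x; rewrite /F /shift_fix /= mix_act_cons.
      by move=> [_ /(congr1 tail_bits)].
    by move=> ->.
  apply/negligibleP.
    rewrite (_ : F n = tail_bits @^-1` shift_fix d e (d n)).
      rewrite -[X in measurable X]setTI.
      apply: (measurable_cantor (f := tail_bits)) => //.
        by move=> k b; exact: measurable_coord.
      exact: measurable_shift_fix.
    have FP x : (cons_bit (x 0%N) @^-1` F n) (tail_bits x) = F n x.
      by rewrite /preimage /mkset cons_tail.
    by apply/seteqP; split=> x; rewrite -FP FE.
  by rewrite /= /mix !FE coin_shift_fix // !mule0 adde0.
apply: negligibleS (negligible_bigcup F0) => x /= nx.
have [s1 sM] := mix_act_action.
apply: contrapT => H; apply: nx; apply/seteqP; split=> g /=; last first.
  by move=> ->; rewrite /stabiliser /= s1.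
rewrite /stabiliser /= => gx; apply: contrapT => /eqP g1; apply: H.
by exists (e g) => //; split; rewrite eK.
Qed.

(** On each of the two copies an almost invariant set is null or conull. *)
Lemma mix_act_ergodic_parts C : measurable C ->
  (forall g, mix (C `\` mix_act g @^-1` C) = 0%E) ->
  [\/ mix C = 0%E, mix C = t%:E, mix C = (1 - t)%:E | mix C = 1%E].
Proof.
move=> mC Cinv.
have H b : coin R (cons_bit b @^-1` C) = 0%E \/ coin R (cons_bit b @^-1` C) = 1%E.
  apply: (coin_ergodic dK eK); first exact: measurable_cons_preimage.
  by move=> g; exact: mix_eq0 (Cinv g) b.
rewrite /mix; case: (H true) => ->; case: (H false) => ->;
  rewrite ?mule0 ?mule1 ?adde0 ?add0e.
- exact: Or41.
- exact: Or43.
- exact: Or42.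
- by rewrite -EFinD addrC subrK; exact: Or44.
Qed.

Definition mix_action (Gtf : torsion_free G) : free_pmp_action R G :=
  FreePmpAction (cantor_standard R) mix_act_action measurable_mix_act
    mix_act_preserving (mix_act_free Gtf).

End MixAction.
End Mixture.


(** * Orbit equivalence and invariant sets *)

Section OrbitEquivalence.
Variables (R : realType) (G H : groupType) (d : nat -> G).
Hypothesis d_surj : forall g, exists n, d n = g.
Variables (a : free_pmp_action R G) (b : free_pmp_action R H).
Local Notation mu := (fpa_prob a).
Local Notation nu := (fpa_prob b).

(** The image under F of an invariant set A is only almost invariant: one has to
    discard the points x with some translate outside the domain X0 of F, or
    whose orbit is not mapped onto an orbit. These form a null set because the
    group is countable. For the other x in A, every translate of F x is the
    image of a translate of x, which lies in A. *)
Lemma orbit_equivalent_invariant_set A : orbit_equivalent a b ->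
  measurable A -> (forall g x, A x -> A (fpa_act g x)) ->
  exists B, [/\ measurable B, nu B = mu A &
    forall h, nu (B `\` @fpa_act _ _ b h @^-1` B) = 0%E].
Proof.
move=> [F [[X0 [Y0 [[mX0 X0_0] _ _ _ Fmu]]] [N [mN N0 FN]]]] mA Ainv.
pose X2 := \bigcap_n (@fpa_act _ _ a (d n) @^-1` X0).
have mX2n n : measurable (@fpa_act _ _ a (d n) @^-1` X0).
  by rewrite -[X in measurable X]setTI; exact: fpa_measurable.
have mX2 : measurable X2 by exact: bigcapT_measurable.
have X2_0 : mu (~` X2) = 0%E.
  apply/negligibleP; first exact: measurableC.
  rewrite /X2 setC_bigcap; apply: negligible_bigcup => n.
  apply/negligibleP; first exact: measurableC.
  by apply: etrans X0_0; apply: fpa_preserving; exact: measurableC.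
(* W: the points at which every step of the transfer is legitimate. *)
pose W := X2 `\` N.
have mW : measurable W by exact: measurableD.
have W0 : mu (~` W) = 0%E.
  apply/negligibleP; first exact: measurableC.
  rewrite /W setCD; apply: negligibleU; apply/negligibleP => //.
  exact: measurableC.
have muI Z : measurable Z -> mu (~` Z) = 0%E -> mu (A `&` Z) = mu A.
  move=> mZ Z0; rewrite [RHS](measureDI _ mA mZ).
  rewrite [X in (X + _)%E](_ : _ = 0%E) ?add0e //.
  apply: (subset_measure0 _ _ _ Z0).
  - exact: measurableD.
  - exact: measurableC.
  - by move=> x [].
have WX0 : W `<=` X0.
  move=> x [/= xX2 _]; have [n dn] := d_surj 1%g.
  by have := xX2 n I; rewrite /= dn (fpa_action a).1.
pose B := F @` (A `&` X0); pose B' := F @` (A `&` W).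
have [mB BA] := Fmu _ (measurableI _ _ mA mX0) (@subIsetr _ _ _).
have AWX0 : A `&` W `<=` X0 by move=> x [_ /WX0].
have [mB' BA'] := Fmu _ (measurableI _ _ mA mW) AWX0.
have mBh h : measurable (@fpa_act _ _ b h @^-1` B).
  by rewrite -[X in measurable X]setTI; exact: fpa_measurable.
exists B; split => [//||h]; first by rewrite [LHS]BA muI.
have B'B : B' `<=` B.
  by move=> _ [x [Ax Wx] <-]; exists x => //; split=> //; exact: WX0.
apply: (subset_measure0 (B := B `\` B')).
- by apply: measurableD.
- exact: measurableD.
- move=> y [By nBy]; split=> // -[x [Ax [X2x Nx]] xy]; apply: nBy.
  have : action_orbit (@fpa_act _ _ b) (F x) (fpa_act h y).
    by exists h; rewrite ?xy.
  have <- : F @` action_orbit (@fpa_act _ _ a) x = action_orbit (@fpa_act _ _ b) (F x).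
    by apply: contrapT => nF; apply: Nx; exact: FN.
  move=> [_ [g _ <-] Fg]; exists (fpa_act g x) => //; split; first exact: Ainv.
  by have [n <-] := d_surj g; exact: X2x.
- rewrite measureD // ?(setIidr B'B).
    by rewrite [X in (X - _)%E]BA [X in (_ - X)%E]BA' !muI // subee // fin_num_measure.
  by rewrite ltey_eq fin_num_measure.
Qed.

End OrbitEquivalence.

(** The powers of x are pairwise distinct. *)
Lemma torsion_free_enum (G : groupType) : countable [set: G] ->
  torsion_free G -> (exists x : G, x != 1%g) ->
  exists (d : nat -> G) (e : G -> nat), cancel d e /\ cancel e d.
Proof.
move=> Gc Gtf [x x1].
have Ginf : ~ finite_set [set: G].
  move=> Gfin; apply: infinite_nat.
  rewrite -(preimage_setT (fun n => (x ^+ n)%g)); apply: finite_preimage => //.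
  suff H m n : (m < n)%N -> (x ^+ m)%g <> (x ^+ n)%g.
    by move=> m n _ _ mn; case: (ltngtP m n) => // /H; rewrite mn.
  move=> mn E; move/eqP: x1; apply; apply: (Gtf x (n - m)%N).
    by rewrite subn_gt0.
  by rewrite expgnFr ?(ltnW mn) // E mulgV.
have /card_set_bijP[e ebij] := eq_card_nat Gc Ginf.
have [d eK dK] : bijective e by rewrite -setTT_bijective.
by exists d, e.
Qed.

(** * Continuum many masses *)

Section Weights.
Variable R : realType.
Local Open Scope ring_scope.

Definition ternary_sum (z : cantor) (n : nat) : R := \sum_(k < n) (z k)%:R / 3 ^+ k.+1.

Lemma ternary_sumS z n :
  ternary_sum z n.+1 = ternary_sum z n + (z n)%:R / 3 ^+ n.+1.
Proof. by rewrite /ternary_sum big_ord_recr. Qed.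

(** The tail is at most the geometric sum of the 3 ^- k.+1. *)
Lemma ternary_sum_le z m n :
  ternary_sum z (n + m) <= ternary_sum z n + (3 ^- n - 3 ^- (n + m)) / 2.
Proof.
elim: m => [|m IH]; first by rewrite addn0 subrr mul0r addr0.
rewrite addnS ternary_sumS.
apply: le_trans (lerD IH (_ : _ <= 3 ^- (n + m).+1)) _.
  rewrite -[leRHS]mul1r ler_pM2r ?invr_gt0 ?exprn_gt0 //.
  by case: (z _); rewrite /= ?lexx ?ler01.
rewrite exprS invfM; move: (3 ^- n) (3 ^- (n + m)) (ternary_sum z n) => p q r; lra.
Qed.

Lemma ternary_sum_ub z n m : ternary_sum z m <= ternary_sum z n + 3 ^- n / 2.
Proof.
have p k : 0 <= (3 ^- k : R) by rewrite invr_ge0 exprn_ge0.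
have [nm|/ltnW mn] := leqP n m.
  rewrite -(subnKC nm); apply: (le_trans (ternary_sum_le z _ _)).
  by rewrite lerD2l ler_pM2r // gerBl.
apply: (@le_trans _ _ (ternary_sum z n)); last by rewrite lerDl divr_ge0.
rewrite /ternary_sum -(subnKC mn) big_split_ord /= lerDl sumr_ge0 // => k _.
Qed.

Definition ternary (z : cantor) : R := sup (range (ternary_sum z)).

Lemma ternary_ge z n : ternary_sum z n <= ternary z.
Proof.
apply: ub_le_sup; last by exists n.
by exists (ternary_sum z 0 + 3 ^- 0 / 2) => _ [m _ <-]; exact: ternary_sum_ub.
Qed.

Lemma ternary_le z n : ternary z <= ternary_sum z n + 3 ^- n / 2.
Proof.
apply: ge_sup; first by exists (ternary_sum z 0), 0%N.
by move=> _ [m _ <-]; exact: ternary_sum_ub.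
Qed.

(** The digits 0 and 1 leave room in base 3: at the first difference one gains
    3 ^- n.+1, and all later digits together weigh at most half of that. *)
Lemma ternary_inj : injective ternary.
Proof.
move=> z w zw; apply: contrapT => /first_diffP; set n := first_diff z w.
have H x y : x n = true -> y n = false ->
    (forall k, (k < n)%N -> x k = y k) -> ternary x <> ternary y.
  move=> xn yn xyn xy; have := ternary_ge x n.+1; have := ternary_le y n.+1.
  have -> : ternary_sum y n.+1 = ternary_sum x n.
    rewrite ternary_sumS yn mul0r addr0.
    by apply: eq_bigr => k _; rewrite xyn.
  rewrite -xy ternary_sumS xn mul1r.
  have : 0 < (3 ^- n.+1 : R) by rewrite invr_gt0 exprn_gt0.
  lra.
case; case zn: (z n); case wn: (w n) => // _ zwn.
  exact: (H z w).
by apply: (H w z) => // k /zwn.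
Qed.

Definition interleave (x y : nat -> bool) : cantor :=
  fun n => if odd n then y n./2 else x n./2.

Lemma interleave_inj x y x' y' :
  interleave x y = interleave x' y' -> (x, y) = (x', y').
Proof.
move=> E; congr (_, _); apply/funext => n.
  by have := congr1 (fun z => z n.*2) E; rewrite /interleave odd_double doubleK.
have := congr1 (fun z => z n.*2.+1) E.
by rewrite /interleave /= odd_double /= uphalf_double.
Qed.

(** The bounds 0 and 1/2 on the ternary sum give weights in [1/6, 1/4]. Staying
    below 1/2 lets the smaller of the two masses be recognized. *)
Definition weight (x y : nat -> bool) : R := (1 + ternary (interleave x y)) / 6.

Lemma weight_bounds x y : 0 < weight x y < 1 / 2.
Proof.
have := ternary_ge (interleave x y) 0; have := ternary_le (interleave x y) 0.
rewrite /weight /ternary_sum big_ord0 expr0 invr1 => ? ?.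
by apply/andP; split; lra.
Qed.

Lemma weight_inj x y x' y' : weight x y = weight x' y' -> (x, y) = (x', y').
Proof. by move=> E; apply/interleave_inj/ternary_inj; move: E; rewrite /weight; lra. Qed.

End Weights.

(** * Conclusion *)

Section Main.
Variable R : realType.

(** The set of points of the first copy is invariant and has measure t, hence t
    is one of 0, u, 1 - u and 1; as t and u are in ]0, 1/2[, it is u. *)
Lemma mix_action_weight (G H : groupType) (t u : R)
    (t01 : (0 < t < 1)%R) (u01 : (0 < u < 1)%R)
    (dG : nat -> G) (eG : G -> nat) (dKG : cancel dG eG) (eKG : cancel eG dG)
    (Gtf : torsion_free G)
    (dH : nat -> H) (eH : H -> nat) (dKH : cancel dH eH) (eKH : cancel eH dH)
    (Htf : torsion_free H) :
  (t < 1 / 2)%R -> (u < 1 / 2)%R ->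
  orbit_equivalent (mix_action t01 dKG eKG Gtf) (mix_action u01 dKH eKH Htf) ->
  t = u.
Proof.
move=> t2 u2 oe.
have mA : measurable [set x : cantor | x 0%N = true] by exact: measurable_coord.
have dG_surj g : exists n, dG n = g by exists (eG g); rewrite eKG.
have [|B [mB BA Bh]] := orbit_equivalent_invariant_set dG_surj oe mA.
  by move=> g x.
have At : mix t [set x : cantor | x 0%N = true] = t%:E.
  rewrite /mix (_ : cons_bit true @^-1` _ = setT); last by apply/seteqP; split.
  rewrite (_ : cons_bit false @^-1` _ = set0); last by apply/seteqP; split.
  by rewrite measure0 probability_setT mule1 mule0 adde0.
move: (t01) (u01) => /andP[t_gt0 _] /andP[u_gt0 _].
have := mix_act_ergodic_parts u01 dKH eKH mB Bh.
have -> : mix u B = t%:E by rewrite -At; exact: BA.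
by case=> -[] tu //; move: t_gt0 u_gt0 t2 u2; rewrite tu; lra.
Qed.

End Main.

Theorem theorem1p7 (R : realType) :
  exists G : (nat -> bool) -> groupType,
    (forall i : nat -> bool, finitely_generated (G i)) /\
    (forall i : nat -> bool, torsion_free (G i)) /\
    (forall i j : nat -> bool, i <> j -> ~ isomorphic_groups (G i) (G j)) /\
    exists a : forall i : nat -> bool, (nat -> bool) -> free_pmp_action R (G i),
      forall i s j t : nat -> bool,
        (i, s) <> (j, t) -> ~ orbit_equivalent (a i s) (a j t).
Proof.
exists hall_family; split; first exact: hall_family_fg.
split; first exact: hall_family_tf.
split; first by move=> i j ij /hall_family_inj.
have enum i := torsion_free_enum
  (finitely_generated_countable (hall_family_fg i)) (@hall_family_tf i)
  (hall_family_nontrivial i).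
pose d i := cid (enum i); pose e i := cid (projT2 (d i)).
have de i : cancel (projT1 (d i)) (projT1 (e i)) /\
    cancel (projT1 (e i)) (projT1 (d i)) := projT2 (e i).
have w01 i s : (0 < weight R i s < 1)%R.
  by have /andP[-> /lt_trans->] := weight_bounds R i s => //; lra.
exists (fun i s => mix_action (w01 i s) (de i).1 (de i).2 (@hall_family_tf i)).
move=> i s j t ijst oe; apply/ijst/(@weight_inj R).
apply: mix_action_weight oe.
- by case/andP: (weight_bounds R i s).
- by case/andP: (weight_bounds R j t).
Qed.
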